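(* Let $M\ge 1$ be an integer, let $L,r,f_B>0$, let $0\le C<ML$, and let $\lambda_1,\dots,\lambda_M>0$. Consider the cache allocation problem $$\min_{(l_1,\dots,l_M)}\ \sum_{i=1}^{M}\frac{r}{f_B}\ln\left(\frac{L-l_i}{l_i+\frac{r}{\lambda_i}}+1\right)\quad\text{subject to}\quad \sum_{i=1}^{M}l_i\le C,\qquad 0\le l_i\le L\ \ (i=1,\dots,M).$$ Then the optimal cache allocation is $$l_i=\min\left(\left(\beta r-\frac{r}{\lambda_i}\right)^+,L\right),\qquad i\in\{1,\dots,M\},$$ where $\beta$ is determined by the storage constraint $\sum_{i=1}^M l_i=C$ (and can be found by bisection).
   Context: Notation: $x^+=\max(x,0)$. Interpretation: $M$ videos, each of length $L$ and bitrate $r$; $l_i$ is the cache size allocated at every client to video $i$; $\lambda_i=p_i\lambda$ is the request rate of video $i$ ($p_i$ its popularity, $\lambda$ the total request rate); $C$ is the client cache size; the $i$-th summand is the average bandwidth consumption of video $i$ under the client caching enabled multicast patching mechanism when clients watch videos in full. *)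

(* Defs.v *)
From mathcomp Require Import all_boot all_order all_algebra.
From mathcomp Require Import all_classical all_reals all_analysis.

Set Implicit Arguments.
Unset Strict Implicit.
Unset Printing Implicit Defensive.

Import Order.TTheory GRing.Theory Num.Theory.
Import numFieldNormedType.Exports.

Local Open Scope ring_scope.

(* Average bandwidth of a video of length [L] and bitrate [r], requested at rate
   [lam], when every client caches an amount [x] of it. *)
Definition bandwidth (R : realType) (L r fB lam x : R) : R :=
  r / fB * ln ((L - x) / (x + r / lam) + 1).

Definition total_bandwidth (R : realType) (M : nat) (L r fB : R)
    (lam l : 'I_M -> R) : R :=
  \sum_(i < M) bandwidth L r fB (lam i) (l i).

Definition feasible (R : realType) (M : nat) (L C : R) (l : 'I_M -> R) : Prop :=
  \sum_(i < M) l i <= C /\ forall i : 'I_M, 0 <= l i <= L.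

Definition optimal (R : realType) (M : nat) (L r fB C : R)
    (lam l : 'I_M -> R) : Prop :=
  feasible L C l /\
  forall l' : 'I_M -> R, feasible L C l' ->
    total_bandwidth L r fB lam l <= total_bandwidth L r fB lam l'.

Definition alloc (R : realType) (M : nat) (L r : R) (lam : 'I_M -> R)
    (beta : R) (i : 'I_M) : R :=
  Num.min (Num.max (beta * r - r / lam i) 0) L.

Definition storage (R : realType) (M : nat) (L r : R) (lam : 'I_M -> R)
    (beta : R) : R :=
  \sum_(i < M) alloc L r lam beta i.

(* The bracket [(lo, hi)] reached after [n] bisection steps for the equation
   [g x = c], intended for nondecreasing [g]. *)
Definition bisection_step (R : realType) (g : R -> R) (c : R) (b : R * R) :
    R * R :=
  let mid := (b.1 + b.2) / 2 in
  if g mid <= c then (mid, b.2) else (b.1, mid).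

Definition bisection (R : realType) (g : R -> R) (c lo hi : R) (n : nat) :
    R * R :=
  iter n (bisection_step g c) (lo, hi).

(* Main.v *)
(* The objective is separable and strictly convex, since the i-th summand is
   [r / fB * (ln (L + r / lam i) - ln (l i + r / lam i))].  For [0 < beta] the
   water-filling point satisfies the KKT conditions with multiplier
   [1 / (fB * beta)]: concavity of [ln] and complementary slackness bound each
   term's loss by [r / fB * (l i - alloc i) / (beta * r)], strictly where [l] and
   [alloc] differ, and these bounds sum to at most 0 by the storage constraint.
   For [beta <= 0] the allocation vanishes, so [C = 0] and nothing else is
   feasible. *)
Require Import Defs.
From mathcomp Require Import all_boot all_order all_algebra.
From mathcomp Require Import all_classical all_reals all_analysis.
From mathcomp Require Import ring lra.

Set Implicit Arguments.
Unset Strict Implicit.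
Unset Printing Implicit Defensive.

Import Order.TTheory GRing.Theory Num.Theory.
Import numFieldNormedType.Exports.

Local Open Scope classical_set_scope.
Local Open Scope ring_scope.

Section Bisection.
Context {R : realType}.
Variables (g : R -> R) (c lo hi : R).

Local Notation b := (bisection g c lo hi).

Lemma bisection_bracket n :
  g lo <= c <= g hi -> g (b n).1 <= c <= g (b n).2.
Proof.
move=> gc; elim: n => [//|n /andP[IHlo IHhi]].
rewrite /bisection iterS -/(b n) /bisection_step.
case: ifPn => [->|]; first by rewrite IHhi.
by rewrite -ltNge => /ltW ->; rewrite IHlo.
Qed.

Lemma bisection_width n : (b n).2 - (b n).1 = geometric (hi - lo) 2^-1 n.
Proof.
elim: n => [|n IH]; first by rewrite /= expr0 mulr1.
rewrite /bisection iterS -/(b n) /bisection_step.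
by rewrite /= exprSr mulrA -[_ * _ ^+ n]IH; case: ifP => _ /=; lra.
Qed.

Lemma bisection_le n : lo <= hi -> (b n).1 <= (b n).2.
Proof.
by move=> lohi; rewrite -subr_ge0 bisection_width mulr_ge0 ?subr_ge0 ?exprn_ge0.
Qed.

Lemma bisection_nested n : lo <= hi ->
  (b n).1 <= (b n.+1).1 /\ (b n.+1).2 <= (b n).2.
Proof.
move=> /(bisection_le n); rewrite /bisection iterS -/(b n) /bisection_step.
by case: ifP => _ /=; split; lra.
Qed.

(** The lower ends increase and stay below [hi], so they converge; the widths shrink geometrically,
    so the upper ends share the limit. Continuity carries the bracketing of [c] to the limit from
    both sides, which forces equality there. *)
Lemma bisection_cvg : continuous g -> lo <= hi -> g lo <= c <= g hi ->
  exists x : R, [/\ (fun n => (b n).1) @ \oo --> x,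
                    (fun n => (b n).2) @ \oo --> x & g x = c].
Proof.
move=> gC lohi gc.
have hiB n : (b n).2 <= hi.
  by elim: n => // n; apply: le_trans; case: (bisection_nested n lohi).
have loC : cvgn (fun n => (b n).1).
  apply: nondecreasing_is_cvgn.
    by apply/nondecreasing_seqP => n; case: (bisection_nested n lohi).
  by exists hi => _ [n _ <-]; apply: le_trans (hiB n); exact: bisection_le.
move/cvg_ex: loC => [x lox].
have hix : (fun n => (b n).2) @ \oo --> x.
  have wE : (fun n => (b n).2) = (fun n => (b n).1 + geometric (hi - lo) 2^-1 n).
    by apply/funext => n; rewrite -bisection_width; lra.
  rewrite wE -[X in _ --> X]addr0; apply: cvgD => //.
  by apply: cvg_geometric; rewrite ger0_norm; lra.
have gE u : u @ \oo --> x -> (g \o u) @ \oo --> g x.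
  by apply: continuous_cvg; exact: gC.
exists x; split => //; apply/eqP; rewrite eq_le; apply/andP; split.
- apply: (cvgr_to_le (gE _ lox)).
  by apply: nearW => n /=; have /andP[] := bisection_bracket n gc.
- apply: (cvgr_to_ge (gE _ hix)).
  by apply: nearW => n /=; have /andP[] := bisection_bracket n gc.
Qed.

End Bisection.

(** Strict concavity of [ln], seen through its tangent at [x]: apply [1 + t < expR t] at the nonzero
    point [t = ln (y / x)]. *)
Lemma ln_diff_lt (R : realType) (x y : R) :
  0 < x -> 0 < y -> y != x -> ln y - ln x < (y - x) / x.
Proof.
move=> x0 y0 yx.
have lnq : ln (y / x) = ln y - ln x by rewrite ln_div.
have ln_neq0 : ln y - ln x != 0.
  by rewrite subr_eq0; apply: contra_neq yx => /ln_inj; apply; rewrite posrE.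
have := expR_gt1Dx ln_neq0; rewrite -lnq lnK ?posrE ?divr_gt0// lnq.
by rewrite mulrBl divff ?gt_eqF//; lra.
Qed.

(* Complementary slackness: [x + a] lies below (resp. above) the water level
   [k] exactly where the clipping forces [y - x <= 0] (resp. [0 <= y - x]). *)
Lemma clip_slackness (R : realType) (k a L y : R) :
  0 < k -> 0 < a -> 0 <= y <= L ->
  let x := Num.min (Num.max (k - a) 0) L in
  (y - x) / (x + a) <= (y - x) / k.
Proof.
move=> k0 a0 /andP[y0 yL]; rewrite /Num.min /Num.max.
case: (ltP (k - a) 0) => ka.
  case: (ltP 0 L) => L0 /=.
    by rewrite add0r subr0 ler_wpM2l// lef_pV2 ?posrE//; lra.
  by rewrite (_ : y - L = 0) ?mul0r//; lra.
case: (ltP (k - a) L) => kaL /=; first by rewrite subrK.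
(* At the upper clip the difference of the two sides is a product of two nonpositive factors:
   [y <= L], and [L + a <= k]. *)
rewrite -subr_ge0 -mulrBr mulr_le0// ?subr_le0//.
by rewrite lef_pV2 ?posrE//; lra.
Qed.

Section Allocation.
Context {R : realType} (M : nat) (L r fB C : R) (lam : 'I_M -> R).
Hypotheses (hL : 0 < L) (hr : 0 < r) (hfB : 0 < fB).
Hypothesis hlam : forall i, 0 < lam i.

Local Notation alloc := (alloc L r lam).
Local Notation storage := (storage L r lam).
Local Notation total := (total_bandwidth L r fB lam).

Lemma bandwidthE i x : 0 <= x ->
  bandwidth L r fB (lam i) x = r / fB * (ln (L + r / lam i) - ln (x + r / lam i)).
Proof.
move=> x0; have a0 : 0 < r / lam i by rewrite divr_gt0.
have La : 0 < L + r / lam i by rewrite addr_gt0.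
have xa : 0 < x + r / lam i by rewrite ltr_wpDl.
rewrite /bandwidth -ln_div ?posrE//; congr (_ * ln _).
by rewrite -[X in _ + X](divff (lt0r_neq0 xa)) -mulrDl; congr (_ / _); ring.
Qed.

Lemma alloc_bound beta i : 0 <= alloc beta i <= L.
Proof.
by rewrite /Defs.alloc le_min ge_min le_max !lexx (ltW hL) !orbT.
Qed.

Lemma alloc_le0 beta i : beta <= 0 -> alloc beta i = 0.
Proof.
move=> b0; have a0 : 0 < r / lam i by rewrite divr_gt0.
rewrite /Defs.alloc max_r ?min_l ?(ltW hL)//.
by rewrite subr_le0 (le_trans _ (ltW a0))// pmulr_lle0.
Qed.

(** The tangent to [ln] at the allocated point has a slope depending on [i]; slackness trades it for
    [1 / (beta * r)], common to all videos, so that the bounds can be summed. *)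
Lemma bandwidth_alloc_lt beta i y : 0 < beta -> 0 <= y <= L ->
  y != alloc beta i ->
  bandwidth L r fB (lam i) (alloc beta i) - bandwidth L r fB (lam i) y <
  r / fB * ((y - alloc beta i) / (beta * r)).
Proof.
move=> b0 yL yx; have a0 : 0 < r / lam i by rewrite divr_gt0.
have /andP[x0 _] := alloc_bound beta i; have /andP[y0 _] := yL.
rewrite !bandwidthE// -mulrBr ltr_pM2l ?divr_gt0//.
apply: (@lt_le_trans _ _ ((y - alloc beta i) / (alloc beta i + r / lam i))).
  have := @ln_diff_lt R (alloc beta i + r / lam i) (y + r / lam i).
  rewrite !ltr_wpDl// (inj_eq (addIr _)) => /(_ isT isT yx).
  by rewrite opprD addrACA subrr addr0; lra.
exact: clip_slackness (mulr_gt0 b0 hr) a0 yL.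
Qed.

Lemma total_alloc_lt beta l : storage beta = C -> feasible L C l ->
  (exists i, l i != alloc beta i) -> total (alloc beta) < total l.
Proof.
move=> bC [lC lL] [i li].
have [b0|b0] := leP beta 0.
  have C0 : C = 0.
    by rewrite -bC /Defs.storage big1// => j _; exact: alloc_le0.
  have l0 j : true -> 0 <= l j by case/andP: (lL j).
  have : \sum_j l j = 0.
    by apply/le_anti; rewrite (sumr_ge0 _ l0) -[X in _ <= X]C0 lC.
  by move/psumr_eq0P => /(_ l0) /(_ i isT) l0i; rewrite alloc_le0// l0i eqxx in li.
rewrite -subr_lt0 /total_bandwidth -sumrB.
apply: (@lt_le_trans _ _
  (\sum_j r / fB * ((l j - alloc beta j) / (beta * r)))).
  (* The differing video [i] is split off to supply strictness; for the others a weak bound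
     suffices, with both sides zero where the allocations agree. *)
  rewrite (bigD1 i)//= [ltRHS](bigD1 i)//= ltr_leD//; first exact: bandwidth_alloc_lt.
  apply: ler_sum => j _; have [<-|lj] := eqVneq (l j) (alloc beta j).
    by rewrite !subrr mul0r mulr0.
  by apply/ltW; exact: bandwidth_alloc_lt.
rewrite -mulr_sumr -mulr_suml sumrB -/(storage beta) bC.
by rewrite pmulr_rle0 ?divr_gt0// pmulr_lle0 ?invr_gt0 ?mulr_gt0// subr_le0.
Qed.

Lemma optimal_alloc beta l : storage beta = C ->
  optimal L r fB C lam l <-> forall i, l i = alloc beta i.
Proof.
move=> bC.
have feas : feasible L C (alloc beta).
  by split; [rewrite -/(storage beta) bC | exact: alloc_bound].
split=> [[lF lopt] i|/funext ->].
  apply/eqP/negPn/negP => li.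
  have := total_alloc_lt bC lF (ex_intro _ i li).
  by rewrite ltNge lopt.
split=> // l' l'F.
have [[i li]|eq_l'] := pselect (exists i, l' i != alloc beta i).
  by apply/ltW/(total_alloc_lt bC l'F); exists i.
suff -> : l' = alloc beta by [].
by apply/funext => i; apply/eqP/negPn/negP => li; apply: eq_l'; exists i.
Qed.

Lemma storage_continuous : continuous storage.
Proof.
move=> x; apply: cvg_big => [|i _]; first exact: add_continuous.
pose f beta : R := beta * r - r / lam i.
have fC : continuous f.
  by move=> y; apply: cvgB; [exact: mulrr_continuous|exact: cvg_cst].
have cC (a : R) : continuous (fun _ : R => a) by move=> y; exact: cvg_cst.
exact: min_fun_continuous (max_fun_continuous fC (cC 0)) (cC L) x.
Qed.

Lemma storage0 : storage 0 = 0.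
Proof. by rewrite /Defs.storage big1// => i _; exact: alloc_le0. Qed.

(** The sum of the [(lam i)^-1] dominates each of its terms, so at this level
    [beta * r - r / lam i >= L] for all [i] at once and every video is capped at [L]. *)
Lemma storage_full : storage (L / r + \sum_i (lam i)^-1) = M%:R * L.
Proof.
rewrite /Defs.storage (eq_bigr (fun=> L)) => [|i _].
  by rewrite sumr_const card_ord mulr_natl.
rewrite /Defs.alloc min_r// le_max; apply/orP; left.
rewrite mulrDl divfK ?gt_eqF// (bigD1 i)//= mulrDl -addrA.
rewrite [_^-1 * r]mulrC addrAC subrr add0r lerDl mulr_ge0// ?(ltW hr)//.
by apply: sumr_ge0 => j _; rewrite invr_ge0 ltW.
Qed.

End Allocation.

Theorem lemma2 (R : realType) (M : nat) (L r fB C : R) (lam : 'I_M -> R)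
    (hM : (1 <= M)%N) (hL : 0 < L) (hr : 0 < r) (hfB : 0 < fB)
    (hC0 : 0 <= C) (hC : C < M%:R * L) (hlam : forall i : 'I_M, 0 < lam i) :
  [/\ exists beta : R, storage L r lam beta = C,
      forall beta : R, storage L r lam beta = C ->
        forall l : 'I_M -> R,
          optimal L r fB C lam l <->
          forall i : 'I_M, l i = alloc L r lam beta i,
      storage L r lam 0 <= C
        <= storage L r lam (L / r + \sum_(i < M) (lam i)^-1)
    & forall lo hi : R, lo <= hi ->
        storage L r lam lo <= C <= storage L r lam hi ->
        exists beta : R,
          [/\ (fun n : nat => (bisection (storage L r lam) C lo hi n).1)
                @ \oo --> beta,
              (fun n : nat => (bisection (storage L r lam) C lo hi n).2)
                @ \oo --> beta
            & storage L r lam beta = C]].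
Proof.
have bracket : storage L r lam 0 <= C
    <= storage L r lam (L / r + \sum_(i < M) (lam i)^-1).
  by rewrite storage0// storage_full// hC0 ltW.
have bisect lo hi :=
  bisection_cvg (c := C) (lo := lo) (hi := hi)
    (@storage_continuous R M L r lam).
split => //; last by move=> beta bC l; exact: optimal_alloc.
have hi0 : 0 <= L / r + \sum_(i < M) (lam i)^-1.
  apply: addr_ge0; first by rewrite divr_ge0 ?ltW.
  by apply: sumr_ge0 => i _; rewrite invr_ge0 ltW.
(* Bisection on the explicit bracket serves as the intermediate value theorem: its limit is the
   required level. *)
by have [beta [_ _ bC]] := bisect _ _ hi0 bracket; exists beta.
Qed.
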